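(* There exist constants $c, C > 0$, independent of $h$, $p$ and $\mathcal{D}$, such that for every integer $p\ge 1$, every $h=1/n$ with $n\ge 1$ an integer, every $\mathcal{D}\subseteq\{0,1\}$ and every $v_h \in S_{p,h,\mathcal{D}}$, $$ c \left( | v_{h}^{reg} |_{H^1(0,1)}^2 + | v_{h}^{out} |_{H^1(0,1)}^2 \right) \leq | v_h |_{H^1(0,1)}^2 \leq C \left( | v_{h}^{reg} |_{H^1(0,1)}^2 + | v_{h}^{out} |_{H^1(0,1)}^2 \right) $$ holds, where $v_{h}^{reg} \in S_{p,h,\mathcal{D}}^{reg}$ and $v_{h}^{out} \in S_{p,h,\mathcal{D}}^{out}$ are such that $v_h = v_{h}^{reg} + v_{h}^{out}$.
   Context: Let $p\ge 1$ be the spline degree, $n\ge1$ an integer, $h=1/n$, and $\mathcal{D}\subseteq\{0,1\}$ (the Dirichlet endpoints). $\pi_p$ denotes polynomials of degree at most $p$. $S_{p,h} = \{ v\in C^{p-1}[0,1] : v|_{[(k-1)h,kh]}\in\pi_p,\ k=1,\dots,n\}$ and $S_{p,h,\mathcal{D}}=\{v\in S_{p,h} : v(x)=0 \text{ for } x\in\mathcal{D}\}$. $S_{p,h,\mathcal{D}}^{reg}$ is the subspace of those $v\in S_{p,h,\mathcal{D}}$ whose even derivatives up to order $p-1$ vanish at the points of $\mathcal{D}$ and whose odd derivatives up to order $p-1$ vanish at the points of $\{0,1\}\setminus\mathcal{D}$, i.e. $\partial^{2k}v(x)=0$ for $x\in\mathcal{D}$, $k=1,\dots,\lfloor\frac{p-1}{2}\rfloor$,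 and $\partial^{2k+1}v(x)=0$ for $x\in\{0,1\}\setminus\mathcal{D}$, $k=0,\dots,\lfloor\frac p2\rfloor-1$. $S_{p,h,\mathcal{D}}^{out}$ is the $L^2(0,1)$-orthogonal complement of $S_{p,h,\mathcal{D}}^{reg}$ in $S_{p,h,\mathcal{D}}$, so that $S_{p,h,\mathcal{D}}=S_{p,h,\mathcal{D}}^{reg}\oplus S_{p,h,\mathcal{D}}^{out}$. $|v|_{H^1(0,1)}=\|v'\|_{L^2(0,1)}$. *)

(* Defs.v *)
From mathcomp Require Import all_boot all_order all_algebra.
From mathcomp Require Import all_classical all_reals all_analysis.

Set Implicit Arguments.
Unset Strict Implicit.
Unset Printing Implicit Defensive.

Import Order.TTheory GRing.Theory Num.Theory numFieldNormedType.Exports.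

Local Open Scope classical_set_scope.
Local Open Scope ring_scope.

(* A function on [0, 1] is represented by a total function R -> R. Every
   notion below, evaluated at points of [0, 1], depends only on the
   restriction to [0, 1]; values outside are irrelevant. *)

Section Calculus01.
Variable R : realType.
Implicit Types (v w : R -> R) (x : R) (k m : nat).

(* Points y tending to x with y <> x and y in [0, 1]: two-sided for x in
   ]0, 1[, one-sided at the endpoints. *)
Definition punctured01 x : set_system R := within `[0, 1] x^'.

Definition diff_quot v x : R -> R := fun y => (v y - v x) / (y - x).

Definition derivable01 v x : Prop := cvg (diff_quot v x @ punctured01 x).

(* As with the library's derive1, the value is meaningful only where the limit
   exists. For a continuous piecewise polynomial the limit exists except
   possibly at the finitely many breakpoints, so deriv01 v is also its weak
   derivative. *)
Definition deriv01 v : R -> R := fun x => lim (diff_quot v x @ punctured01 x).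

Definition deriv01n k v : R -> R := iter k deriv01 v.

(* v is in C^m[0, 1] *)
Definition C01 m v : Prop :=
  (forall k x, (k < m)%N -> x \in `[0, 1] -> derivable01 (deriv01n k v) x) /\
  {within `[0, 1], continuous (deriv01n m v)}.

Definition L2dot v w : R :=
  \int[@lebesgue_measure R]_(x in `[0, 1]) (v x * w x).

Definition L2norm v : R := Num.sqrt (L2dot v v).

Definition H1semi v : R := L2norm (deriv01 v).

End Calculus01.

Section Splines.
Variables (R : realType) (p n : nat).
Local Notation h := (n%:R^-1 : R).

Definition spline : set (R -> R) :=
  [set v | C01 p.-1 v /\
    forall k, (k < n)%N -> exists q : {poly R}, (size q <= p.+1)%N /\
      {in `[k%:R * h, k.+1%:R * h], forall x, v x = q.[x]}].

Definition splineD (D : set R) : set (R -> R) :=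
  [set v | spline v /\ forall x, D x -> v x = 0].

Definition splineD_reg (D : set R) : set (R -> R) :=
  [set v | [/\ splineD D v,
    forall k x, (1 <= k <= (p.-1)./2)%N -> D x -> deriv01n k.*2 v x = 0 &
    forall k x, (k < p./2)%N -> ([set 0; 1] `\` D) x ->
      deriv01n (k.*2.+1) v x = 0]].

Definition splineD_out (D : set R) : set (R -> R) :=
  [set v | splineD D v /\ forall w, splineD_reg D w -> L2dot v w = 0].

End Splines.

(* Main.v *)
Require Import Defs.
From mathcomp Require Import all_boot all_order all_algebra.
From mathcomp Require Import all_classical all_reals all_analysis.
From mathcomp Require Import measurable_realfun.
From mathcomp Require Import ring lra zify.

(* Only the bound on v_reg matters, the rest being the triangle inequality.
   On the regular splines two estimates hold with constants independent of p:
   the inverse inequality |v|_1 <= 2 sqrt(3) n |v|, and the approximation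
   property that each u in H^1 vanishing on D has a regular spline w with
   |u - w| <= (2/n) |u|_1 and |w|_1 <= |u|_1. The boundary conditions of the
   regular splines make the boundary terms of all integrations by parts vanish,
   and differentiation maps the regular splines of degree p + 1 for D into those
   of degree p for the complement of D in {0, 1}, so both estimates follow by
   induction on p. As v_reg is the L^2 projection of v, |v_reg - w| <= |v - w|,
   hence |v_reg - w|_1 <= 2 sqrt(3) n (2/n) |v|_1.
   All functions involved are piecewise polynomials, represented by the
   sequence of their pieces on the n cells (later entries are irrelevant);
   their integrals are computed with formal antiderivatives. *)

Set Implicit Arguments.
Unset Strict Implicit.
Unset Printing Implicit Defensive.
Import Order.TTheory GRing.Theory Num.Theory numFieldNormedType.Exports.
Local Open Scope classical_set_scope.
Local Open Scope ring_scope.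

(** * Orthogonal projection for a positive semidefinite symmetric form *)

Section Projection.
Variables (R : realType) (V : lmodType R) (B : V -> V -> R).
Hypothesis BC : forall x y, B x y = B y x.
Hypothesis BL : forall a x y z, B (a *: x + y) z = a * B x z + B y z.
Hypothesis B_ge0 : forall x, 0 <= B x x.

Lemma form_subl x y z : B (x - y) z = B x z - B y z.
Proof. by rewrite addrC -scaleN1r BL mulN1r addrC. Qed.

Lemma form_subr x y z : B z (x - y) = B z x - B z y.
Proof. by rewrite BC form_subl !(BC z). Qed.

Lemma form_scalel a x y : B (a *: x) y = a * B x y.
Proof.
have B0 : B 0 y = 0 by rewrite -(subrr 0) form_subl subrr.
by rewrite -[a *: x]addr0 BL B0 addr0.
Qed.

Lemma form_Cauchy_Schwarz x y : B x y ^+ 2 <= B x x * B y y.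
Proof.
have sq a : 0 <= a ^+ 2 * B x x - a * B x y *+ 2 + B y y.
  suff -> : a ^+ 2 * B x x - a * B x y *+ 2 + B y y
      = B (a *: x - y) (a *: x - y).
    exact: B_ge0.
  rewrite form_subl !form_subr !form_scalel (BC x (a *: x)) (BC y (a *: x)).
  by rewrite !form_scalel; ring.
have [xx0|xx0] := eqVneq (B x x) 0.
  rewrite xx0 mul0r.
  have [->|xy0] := eqVneq (B x y) 0; first by rewrite expr0n.
  (* This value of [a] would make the now affine expression equal to -1. *)
  have := sq ((B y y + 1) / (2 * B x y)).
  rewrite xx0 mulr0 -mulr_natl.
  have -> : 2%:R * ((B y y + 1) / (2 * B x y) * B x y) = B y y + 1 by field.
  by move=> ?; lra.
have xxp : 0 < B x x by rewrite lt_neqAle eq_sym xx0 B_ge0.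
have := mulr_ge0 (ltW xxp) (sq (B x y / B x x)).
have -> : B x x *
      ((B x y / B x x) ^+ 2 * B x x - B x y / B x x * B x y *+ 2 + B y y)
    = B x x * B y y - B x y ^+ 2 by field.
by rewrite subr_ge0.
Qed.

Lemma form_null x y : B x x = 0 -> B x y = 0.
Proof.
move=> xx0; apply/eqP; rewrite -sqrf_eq0 eq_le sqr_ge0 andbT.
by rewrite (le_trans (form_Cauchy_Schwarz x y))// xx0 mul0r.
Qed.

(** Pythagoras for x = w + (x - w). *)
Lemma form_orthogonal_le w x :
  B (x - w) w = 0 -> B w w <= B x x /\ B (x - w) (x - w) <= B x x.
Proof.
move=> xw0; have e : B x x = B (x - w) (x - w) + B w w.
  have xww : B x w = B w w by move: xw0; rewrite form_subl => /subr0_eq.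
  by rewrite form_subl !form_subr (BC w x) xww; ring.
by rewrite e lerDl lerDr !B_ge0.
Qed.

(* Finite dimensionality of S enters only through finitely many functionals
   that separate the points of S up to null vectors. *)
Lemma orthogonal_projection (l : nat -> V -> R) (m : nat) (S : set V) :
    (forall i a x y, l i (a *: x + y) = a * l i x + l i y) ->
    S 0 -> (forall a x y, S x -> S y -> S (a *: x + y)) ->
    (forall x, S x -> (forall i, (i < m)%N -> l i x = 0) -> B x x = 0) ->
  forall u, exists w, S w /\ forall s, S s -> B (u - w) s = 0.
Proof.
move=> ll; elim: m S => [|m IH] S S0 SL Snull u.
  by exists 0; split=> // s Ss; rewrite BC form_null//; exact: Snull.
pose S' := [set x | S x /\ l m x = 0].
have l0 i : l i 0 = 0.
  by have := ll i (-1) 0 0; rewrite scaler0 addr0 mulN1r addNr.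
have proj' u' : exists w, S' w /\ forall s, S' s -> B (u' - w) s = 0.
  apply: IH => [|a x y [Sx lx] [Sy ly]|x [Sx lx] lx'].
  - by split.
  - by split; [exact: SL|rewrite ll lx ly mulr0 addr0].
  - apply: Snull => // i.
    by rewrite ltnS leq_eqVlt => /predU1P[->//|]; exact: lx'.
have [[v0 [Sv0 lv0]]|nov] := pselect (exists v, S v /\ l m v != 0); last first.
  have [w [[Sw _] wP]] := proj' u; exists w; split=> // s Ss; apply: wP.
  by split=> //; apply/eqP; apply: contrapT => /negP ls; apply: nov; exists s.
have [w [[Sw lw] wP]] := proj' u.
have [w0 [[Sw0 lw0] w0P]] := proj' v0.
(* [e] is orthogonal to S' but not killed by [l m]: it spans what S' lacks in S. *)
pose e := v0 - w0.
have Se : S e by rewrite /e addrC -scaleN1r; exact: SL.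
have le : l m e = l m v0 by rewrite /e addrC -scaleN1r ll lw0 mulr0 add0r.
pose c := B u e / B e e.
exists (c *: e + w); split; first exact: SL.
have res x : B (u - (c *: e + w)) x = B (u - w) x - c * B e x.
  by rewrite (form_subl u (c *: e + w)) (form_subl u w) BL; ring.
move=> s Ss; pose b := l m s / l m v0.
have S's' : S' (s - b *: e).
  split; first by rewrite addrC -scaleNr; exact: SL.
  by rewrite addrC -scaleNr ll le /b; field.
have e0 : B (u - (c *: e + w)) e = 0.
  rewrite res (_ : B (u - w) e = B u e); last first.
    by rewrite form_subl [X in _ - X]BC w0P ?subr0//; split.
  (* The form may be degenerate; if [e] is a null vector, it is orthogonal to everything and any [c]
     would do. *)
  have [ee0|ee0] := eqVneq (B e e) 0.
    by rewrite ee0 mulr0 subr0 BC form_null.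
  by rewrite /c mulfVK// subrr.
have -> : s = b *: e + (s - b *: e) by rewrite addrC subrK.
rewrite BC BL BC e0 mulr0 add0r BC res wP//.
by rewrite w0P// mulr0 subr0.
Qed.
End Projection.

(** * Integrals of polynomials and estimates on one cell *)

Section PolyIntegral.
Variable R : realType.
Implicit Types (f g : {poly R}) (a b : R).

(** The antiderivative without constant term: at i = 0 the division by 0 yields 0. *)
Definition primp f : {poly R} := \poly_(i < (size f).+1) (f`_i.-1 / i%:R).

Lemma coef_primp f i : (primp f)`_i = f`_i.-1 / i%:R.
Proof.
rewrite coef_poly; case: ifP => // /negbT; rewrite -leqNgt => fi.
by rewrite [f`_ _]nth_default ?mul0r// -ltnS prednK// (leq_trans _ fi).
Qed.

Lemma deriv_primp f : (primp f)^`() = f.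
Proof.
by apply/polyP => i; rewrite coef_deriv coef_primp/= -[LHS]mulr_natr mulfVK.
Qed.

Lemma deriv0_const f : f^`() = 0 -> f = (f`_0)%:P.
Proof.
move=> f0; apply/polyP => -[|i]; first by rewrite coefC.
have := coef_deriv f i; rewrite f0 coef0 coefC/= => /esym/eqP.
by rewrite mulrn_eq0/= => /eqP.
Qed.

Lemma size_antideriv f m : (size f^`() <= m)%N -> (size f <= m.+1)%N.
Proof.
move=> fm; apply/leq_sizeP => -[//|j]; rewrite ltnS => mj.
have /eqP := coef_deriv f j; rewrite nth_default ?(leq_trans fm)// eq_sym.
by rewrite mulrn_eq0/= => /eqP.
Qed.

Definition pint a b f : R := (primp f).[b] - (primp f).[a].

Lemma pint_deriv a b f : pint a b f^`() = f.[b] - f.[a].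
Proof.
have : (f - primp f^`())^`() = 0 by rewrite derivB deriv_primp subrr.
move=> /deriv0_const/eqP; rewrite subr_eq => /eqP.
move: (_ `_0) => c e; rewrite /pint [in RHS]e !hornerD !hornerC.
by rewrite opprD addrACA subrr add0r.
Qed.

Lemma pintL a b c f g : pint a b (c *: f + g) = c * pint a b f + pint a b g.
Proof.
rewrite -{1}[f]deriv_primp -{1}[g]deriv_primp -derivZ -derivD pint_deriv /pint.
by rewrite !hornerD !hornerZ mulrBr opprD addrACA.
Qed.

Lemma integral_horner a b f : a < b ->
  (\int[@lebesgue_measure R]_(x in `[a, b]) (f.[x])%:E = (pint a b f)%:E)%E.
Proof.
move=> ab; rewrite (@continuous_FTC2 _ _ (horner (primp f)))//.
- by apply: continuous_subspaceT; exact: continuous_horner.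
- split.
  + by move=> x _; exact: derivable_horner.
  + by apply: cvg_at_right_filter; exact: continuous_horner.
  + by apply: cvg_at_left_filter; exact: continuous_horner.
- by move=> x _; rewrite -derivE deriv_primp.
Qed.

(** The formal antiderivative does not show positivity, which is taken from the Lebesgue
    integral. *)
Lemma pint_ge0 a b f : a <= b -> (forall x, a <= x <= b -> 0 <= f.[x]) ->
  0 <= pint a b f.
Proof.
rewrite le_eqVlt => /predU1P[->|ab] f0; first by rewrite /pint subrr.
rewrite -lee_fin -integral_horner//; apply: integral_ge0 => x /=.
by rewrite in_itv/= lee_fin; exact: f0.
Qed.

(** With s = b - x, parts give int g^2 = 2 int s g g'. Expanding 0 <= int (g - 2 s g')^2 then yields
    int g^2 <= 4 int s^2 g'^2, and s^2 <= (b - a)^2 on the cell. *)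
Lemma pint_poincare a b g : a <= b -> g.[a] = 0 ->
  pint a b (g ^+ 2) <= 4 * (b - a) ^+ 2 * pint a b (g^`() ^+ 2).
Proof.
move=> ab ga; have [s sE] : exists s : {poly R}, s = b%:P - 'X by eexists.
have s' : s^`() = -1 by rewrite sE derivB derivC derivX sub0r.
have sx x : s.[x] = b - x by rewrite sE !hornerE.
(* integration by parts of g^2 against (x - b)' *)
have parts : pint a b (g ^+ 2) = pint a b (2%:R *: (s * g * g^`())).
  have : pint a b (- (s * g ^+ 2))^`() = 0.
    by rewrite pint_deriv !(hornerN,hornerM,horner_exp) ga !sx; ring.
  rewrite (_ : (- (s * g ^+ 2))^`() = (-1) *: (2%:R *: (s * g * g^`())) + g ^+ 2).
    by rewrite pintL => h; lra.
  by rewrite derivN derivM expr2 derivM s' -!mul_polyC polyCN polyC_natr; ring.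
have sq0 : 0 <= pint a b ((g - 2%:R *: (s * g^`())) ^+ 2).
  by apply: pint_ge0 => // x _; rewrite horner_exp sqr_ge0.
have w0 : 0 <= pint a b ((((b - a) ^+ 2)%:P - s ^+ 2) * g^`() ^+ 2).
  apply: pint_ge0 => // x /andP[ax xb]; rewrite hornerM horner_exp.
  rewrite mulr_ge0 ?sqr_ge0// hornerD hornerC hornerN horner_exp sx.
  by rewrite subr_ge0 ler_sqr ?nnegrE ?subr_ge0// lerB.
move: sq0 w0.
rewrite (_ : (g - _) ^+ 2 = (-2%:R) *: (2%:R *: (s * g * g^`()))
   + (1 *: g ^+ 2 + 4%:R *: (s ^+ 2 * g^`() ^+ 2))); last first.
  by rewrite -!mul_polyC polyCN !polyC_natr; ring.
rewrite (_ : (_ - s ^+ 2) * _ = (b - a) ^+ 2 *: g^`() ^+ 2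
   + (-1) *: (s ^+ 2 * g^`() ^+ 2)); last first.
  by rewrite -!mul_polyC polyCN; ring.
rewrite -[4%:R *: _]addr0 -[(-1) *: (s ^+ 2 * _)]addr0 !pintL -parts.
have -> : pint a b 0 = 0.
  by have := pint_deriv a b 0; rewrite deriv0 !horner0 subrr.
by move=> h1 h2; nra.
Qed.

(** For f = c + d x and m the midpoint, the right side exceeds the left by exactly 12 (b - a)
    f(m)^2. *)
Lemma pint_inverse_linear a b f : a <= b -> (size f <= 2)%N ->
  (b - a) ^+ 2 * pint a b (f^`() ^+ 2) <= 12 * pint a b (f ^+ 2).
Proof.
move=> ab f2; pose c := f`_0; pose d := f`_1.
have -> : f = c%:P + d%:P * 'X.
  apply/polyP => -[|[|i]]; rewrite coefD coefCM coefX coefC/=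
    ?mulr0 ?mulr1 ?addr0 ?add0r//.
  by rewrite nth_default// (leq_trans f2).
(* e X^3 is to be the antiderivative of d^2 X^2. *)
have [e de] : exists e, d ^+ 2 = e *+ 3 by exists (d ^+ 2 / 3); field.
rewrite (_ : (c%:P + d%:P * 'X) ^+ 2 =
  ((c ^+ 2)%:P * 'X + (c * d)%:P * 'X^2 + e%:P * 'X^3)^`()); last first.
  have : (d ^+ 2)%:P = e%:P *+ 3 by rewrite de polyCMn.
  rewrite !poly.derivE/= !polyCM => dP.
  by rewrite sqrrD exprMn [d%:P ^+ 2]expr2 dP; ring.
rewrite (_ : (c%:P + d%:P * 'X)^`() ^+ 2 = ((d ^+ 2)%:P * 'X)^`()); last first.
  by rewrite !poly.derivE add0r !mulr1 polyCM.
rewrite !pint_deriv !(hornerD, hornerM, hornerC, hornerX, hornerXn).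
have -> : e = d ^+ 2 / 3 by rewrite de; field.
have ba : 0 <= b - a by rewrite subr_ge0.
have := mulr_ge0 ba (sqr_ge0 (c + d * ((a + b) / 2))).
by rewrite -subr_ge0 => h; rewrite -subr_ge0; lra.
Qed.

End PolyIntegral.

(** * Piecewise polynomials on the uniform mesh *)

Section PiecewisePoly.
Variables (R : realType) (n : nat).
Hypothesis n_gt0 : (0 < n)%N.
Local Notation pw := (nat -> {poly R}).
Implicit Types (f g q u v w : pw) (dl dr : bool).

Definition node k : R := k%:R * n%:R^-1.

(** The L^2(0, 1) product; on sequences it is only semidefinite, being blind to the entries from [n]
    on. *)
Definition pwdot q g : R := \sum_(k < n) pint (node k) (node k.+1) (q k * g k).

Definition pwderiv q : pw := fun k => (q k)^`().

Definition pwcont q : Prop :=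
  forall k, (k.+1 < n)%N -> (q k).[node k.+1] = (q k.+1).[node k.+1].

(* dl and dr tell whether 0 and 1 are Dirichlet endpoints. *)
Definition pwH1 dl dr q : Prop :=
  [/\ pwcont q, dl -> (q 0).[0] = 0 & dr -> (q n.-1).[1] = 0].

(** The parity test joins both kinds of endpoints: even orders, 0 included, vanish at a Dirichlet
    endpoint, odd orders at the other ones. For p = 0 these are the piecewise constants, where the
    induction on the degree starts. *)
Definition pwreg p dl dr : set pw := [set q : pw |
  [/\ forall k, (k < n)%N -> (size (q k) <= p.+1)%N,
      forall j k, (j < p)%N -> (k.+1 < n)%N ->
        (q k)^`(j).[node k.+1] = (q k.+1)^`(j).[node k.+1],
      forall j, (j < p)%N -> odd j (+) dl -> (q 0)^`(j).[0] = 0 &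
      forall j, (j < p)%N -> odd j (+) dr -> (q n.-1)^`(j).[1] = 0]].

Let n_neq0 : n%:R != 0 :> R. Proof. by rewrite pnatr_eq0 -lt0n. Qed.

Lemma node0 : node 0 = 0. Proof. by rewrite /node mul0r. Qed.

Lemma node_last : node n.-1.+1 = 1.
Proof. by rewrite /node prednK// divff. Qed.

Lemma node_step k : node k.+1 - node k = n%:R^-1.
Proof. by rewrite /node -mulrBl -natrB// subSnn mul1r. Qed.

Lemma node_lt k : node k < node k.+1.
Proof. by rewrite -subr_gt0 node_step invr_gt0 ltr0n. Qed.

Lemma pwdotC q g : pwdot q g = pwdot g q.
Proof. by apply: eq_bigr => k _; rewrite mulrC. Qed.

Lemma pwdotL a f g q : pwdot (a *: f + g) q = a * pwdot f q + pwdot g q.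
Proof.
rewrite /pwdot mulr_sumr -big_split/=; apply: eq_bigr => k _.
by rewrite mulrDl -scalerAl pintL.
Qed.

Lemma pwdot_ge0 q : 0 <= pwdot q q.
Proof.
apply: sumr_ge0 => k _; apply: pint_ge0; first exact/ltW/node_lt.
by move=> x _; rewrite -expr2 horner_exp sqr_ge0.
Qed.

Lemma pwderivL a f g : pwderiv (a *: f + g) = a *: pwderiv f + pwderiv g.
Proof. by apply/funext => k; rewrite /pwderiv derivD derivZ. Qed.

Lemma pwderivB f g : pwderiv (f - g) = pwderiv f - pwderiv g.
Proof. by apply/funext => k; rewrite /pwderiv derivB. Qed.

(** Continuity makes the contributions of the interior nodes telescope. *)
Lemma pw_parts f g : pwcont f -> pwcont g ->
  pwdot (pwderiv f) g + pwdot f (pwderiv g) =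
  (f n.-1).[1] * (g n.-1).[1] - (f 0).[0] * (g 0).[0].
Proof.
move=> cf cg; rewrite /pwdot -big_split/=.
under eq_bigr => k _.
  rewrite -[X in X + _]mul1r -pintL scale1r -derivM pint_deriv; over.
pose F m := (f m).[node m.+1] * (g m).[node m.+1] - (f 0).[0] * (g 0).[0].
transitivity (F n.-1); last by rewrite /F node_last.
rewrite -[in LHS](prednK n_gt0); have := ltn_predL n; rewrite n_gt0.
elim: n.-1 => [_|m IH mn]; first by rewrite big_ord1 /F !hornerM node0.
rewrite big_ord_recr/= IH ?(ltn_trans _ mn)// /F !hornerM cf// cg//; ring.
Qed.

Lemma pwreg0 p dl dr : pwreg p dl dr 0.
Proof.
by split=> [k _|j k _ _|j _ _|j _ _]; rewrite ?size_poly0// !raddf0 !horner0.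
Qed.

Lemma pwregL p dl dr a f g :
  pwreg p dl dr f -> pwreg p dl dr g -> pwreg p dl dr (a *: f + g).
Proof.
move=> [fs fc f0 f1] [gs gc g0 g1].
split=> [k kn|j k jp kn|j jp jd|j jp jd].
- rewrite (leq_trans (size_polyD _ _))// geq_max gs//.
  by rewrite (leq_trans (size_scale_leq _ _))// fs.
- by rewrite !derivnD !derivnZ !hornerD !hornerZ fc// gc.
- by rewrite !derivnD !derivnZ !hornerD !hornerZ f0// g0// mulr0 addr0.
- by rewrite !derivnD !derivnZ !hornerD !hornerZ f1// g1// mulr0 addr0.
Qed.

(** The separating functionals are the p + 1 coefficients of each of the n pieces, numbered by
    quotient and remainder modulo p + 1. *)
Lemma pwreg_projection p dl dr u : exists w, pwreg p dl dr w /\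
  forall s, pwreg p dl dr s -> pwdot (u - w) s = 0.
Proof.
apply: (orthogonal_projection pwdotC pwdotL pwdot_ge0 (m := (n * p.+1)%N)
  (l := fun i q => (q (i %/ p.+1)%N)`_(i %% p.+1))).
- by move=> i a x y; rewrite coefD coefZ.
- exact: pwreg0.
- exact: pwregL.
- move=> x [xs _ _ _] x0; apply: big1 => k _.
  suff -> : x k = 0 by rewrite mul0r -[0]deriv0 pint_deriv !horner0 subrr.
  apply/polyP => i; rewrite coef0; have [pi|ip] := leqP p.+1 i.
    by rewrite nth_default// (leq_trans _ pi)// xs.
  have := x0 (k * p.+1 + i)%N; rewrite divnMDl// divn_small// addn0.
  rewrite modnMDl modn_small//; apply.
  rewrite (@leq_trans (k.+1 * p.+1))%N// ?leq_mul2r ?ltn_ord ?orbT//.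
  by rewrite mulSn addnC ltn_add2r.
Qed.

Lemma pwreg_deriv p dl dr q :
  pwreg p.+1 dl dr q -> pwreg p (~~ dl) (~~ dr) (pwderiv q).
Proof.
move=> [qs qc q0 q1]; split=> [k kn|j k jp kn|j jp jd|j jp jd].
- apply/leq_sizeP => j pj; rewrite coef_deriv nth_default ?mul0rn//.
  by rewrite (leq_trans (qs k kn)).
- by rewrite -!derivSn qc.
- by rewrite -!derivSn q0//= addNb -addbN.
- by rewrite -!derivSn q1//= addNb -addbN.
Qed.

(** The conditions of order 0, which differentiation loses, are those of [pwH1]. *)
Lemma pwreg_antideriv p dl dr q : pwH1 dl dr q ->
  pwreg p (~~ dl) (~~ dr) (pwderiv q) -> pwreg p.+1 dl dr q.
Proof.
move=> [qc q0 q1] [qs' qc' q0' q1'].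
split=> [k kn|[|j] k jp kn|[|j] jp jd|[|j] jp jd].
- exact/size_antideriv/qs'.
- exact: qc.
- by rewrite !derivSn qc'.
- exact: q0.
- by rewrite derivSn q0'// addbN -addNb.
- exact: q1.
- by rewrite derivSn q1'// addbN -addNb.
Qed.

Lemma pwregSH1 p dl dr q : pwreg p.+1 dl dr q -> pwH1 dl dr q.
Proof.
move=> [_ qc q0 q1]; split=> [k|d|d]; first exact: (qc 0).
- exact: (q0 0).
- exact: (q1 0).
Qed.

Lemma pwH1L dl dr a f g :
  pwH1 dl dr f -> pwH1 dl dr g -> pwH1 dl dr (a *: f + g).
Proof.
move=> [cf f0 f1] [cg g0 g1]; split=> [k kn|d|d]; rewrite !hornerD !hornerZ.
- by rewrite cf// cg.
- by rewrite f0// g0// mulr0 addr0.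
- by rewrite f1// g1// mulr0 addr0.
Qed.

Let pw1 : pw := fun=> 1.

Lemma pwdot11 : pwdot pw1 pw1 = 1.
Proof.
have -> : pwdot pw1 pw1 = \sum_(k < n) n%:R^-1.
  apply: eq_bigr => k _; rewrite /pw1 mulr1.
  have := @pint_deriv R (node k) (node k.+1) 'X.
  by rewrite derivX !hornerX node_step.
by rewrite sumr_const card_ord -[LHS]mulr_natr mulVf.
Qed.

(** One Dirichlet endpoint fixes the constant of integration, and a second one needs f of mean zero.
    Without any, the constant is spent on making F of mean zero, which is what a further
    antiderivative for the opposite conditions requires. *)
Lemma pwantideriv_ex dl dr f : (dl -> dr -> pwdot f (fun=> 1) = 0) ->
  exists F, [/\ pwderiv F = f, pwH1 dl dr F &
    ~~ dl -> ~~ dr -> pwdot F (fun=> 1) = 0].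
Proof.
move=> f0.
(* The integral of f from 0 to [node k], hence the value F must take there. *)
pose c k := \sum_(i < k) pint (node i) (node i.+1) (f i).
pose F k := primp (f k) + (c k - (primp (f k)).[node k])%:P.
have F' : pwderiv F = f.
  by apply/funext => k; rewrite /pwderiv derivD derivC addr0 deriv_primp.
have FL k : (F k).[node k] = c k by rewrite hornerD hornerC addrC subrK.
have FR k : (F k).[node k.+1] = c k.+1.
  by rewrite hornerD hornerC /c big_ord_recr/= /pint; ring.
have Fc : pwcont F by move=> k _; rewrite FR FL.
have F0 : (F 0).[0] = 0 by have := FL 0; rewrite node0 /c big_ord0.
have F1 : (F n.-1).[1] = pwdot f (fun=> 1).
  by rewrite -node_last FR prednK//; apply: eq_bigr => k _; rewrite mulr1.
clearbody F.
have shift x : let G : pw := x *: pw1 + F in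
    [/\ pwderiv G = f, pwcont G, (G 0).[0] = x, (G n.-1).[1] = x + (F n.-1).[1]
      & pwdot G pw1 = x + pwdot F pw1].
  split.
  - have pw1' : pwderiv pw1 = 0 by apply/funext => k; exact: derivC.
    by rewrite pwderivL F' pw1' scaler0 add0r.
  - by move=> k kn; rewrite !hornerD Fc// !hornerZ !hornerC.
  - by rewrite hornerD F0 hornerZ hornerC mulr1 addr0.
  - by rewrite hornerD hornerZ hornerC mulr1.
  - by rewrite pwdotL pwdot11 mulr1.
case: dl f0 => f0.
  exists F; split=> //; split=> // d; rewrite F1; exact: f0.
case: dr {f0}.
  have [? ? ? G1 ?] := shift (- (F n.-1).[1]).
  exists ((- (F n.-1).[1]) *: pw1 + F); split=> //; split=> //.
  by rewrite G1 addNr.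
have [? ? ? ? G1] := shift (- pwdot F pw1).
exists ((- pwdot F pw1) *: pw1 + F); split=> //.
by rewrite G1 addNr.
Qed.

End PiecewisePoly.

(** * Estimates for regular splines and H^1 stability of the projection *)

Section RegularSplines.
Variables (R : realType) (n : nat).
Hypothesis n_gt0 : (0 < n)%N.
Local Notation pw := (nat -> {poly R}).
Local Notation dot := (@pwdot R n).
Implicit Types (f g q r u v w : pw) (dl dr : bool).

Let dot_ge0 := @pwdot_ge0 R n n_gt0.
Let dotBl := form_subl (@pwdotL R n).
Let dotBr := form_subr (@pwdotC R n) (@pwdotL R n).
Let dotCS := form_Cauchy_Schwarz (@pwdotC R n) (@pwdotL R n) dot_ge0.
Let ortho_le := form_orthogonal_le (@pwdotC R n) (@pwdotL R n) dot_ge0.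

Let nR_gt0 : 0 < n%:R :> R. Proof. by rewrite ltr0n. Qed.

(* Integration by parts gives |v'|^2 <= |v| |v''|, without boundary terms, so
   the ratios of consecutive derivatives increase; the last one is bounded
   cell by cell. *)
Lemma pwreg_inverse p dl dr v : pwreg n p.+1 dl dr v ->
  dot (pwderiv v) (pwderiv v) <= 12 * n%:R ^+ 2 * dot v v.
Proof.
elim: p dl dr v => [|p IH] dl dr v vr.
  case: vr => vs _ _ _; rewrite /pwdot mulr_sumr; apply: ler_sum => k _.
  have := pint_inverse_linear (ltW (node_lt R n_gt0 k)) (vs k (ltn_ord k)).
  rewrite node_step// exprVn ler_pdivrMl ?exprn_gt0// -!expr2.
  by rewrite mulrA [_ * 12]mulrC.
have vr' := pwreg_deriv vr; have IH' := IH _ _ _ vr'.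
have [vc v0 v1] := pwregSH1 vr; have [vc' v0' v1'] := pwregSH1 vr'.
have e : dot (pwderiv v) (pwderiv v) = - dot v (pwderiv (pwderiv v)).
  apply/eqP; rewrite -addr_eq0 pw_parts//.
  (* At each endpoint v or v' vanishes, as v' obeys the opposite conditions. *)
  have -> : (v n.-1).[1] * (pwderiv v n.-1).[1] = 0.
    by have [d|d] := boolP dr; [rewrite v1// mul0r|rewrite v1'// mulr0].
  have [d|d] := boolP dl; first by rewrite v0// mul0r subrr.
  by rewrite v0'// mulr0 subrr.
have := dotCS v (pwderiv (pwderiv v)); rewrite -sqrrN -e.
(* One factor |v'|^2 is cancelled from |v'|^4 <= |v|^2 |v''|^2 <= |v|^2 12 n^2 |v'|^2. *)
have [->|a0] := eqVneq (dot (pwderiv v) (pwderiv v)) 0.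
  by rewrite !mulr_ge0 ?dot_ge0// ltW// exprn_gt0.
have ap : 0 < dot (pwderiv v) (pwderiv v) by rewrite lt_def a0 dot_ge0.
move=> /le_trans/(_ (ler_wpM2l (dot_ge0 v) IH')).
rewrite expr2 !mulrA ler_pM2r// => /le_trans; apply.
by rewrite le_eqVlt; apply/orP; left; apply/eqP; ring.
Qed.

(* The duality argument of the inductive step: with z the projection of u'
   onto the splines of degree p for the opposite boundary conditions, w an
   antiderivative of z, e = u - w and psi' = e,
   |e|^2 = - (e', psi) = - (e', psi - w') for every such spline w', so the
   constant 2/n is inherited from psi. *)
Lemma pwreg_approx p dl dr u : pwH1 n dl dr u -> exists w,
  [/\ pwreg n p dl dr w,
      dot (u - w) (u - w) <= 4 / n%:R ^+ 2 * dot (pwderiv u) (pwderiv u) &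
      (0 < p)%N -> dot (pwderiv w) (pwderiv w) <= dot (pwderiv u) (pwderiv u)].
Proof.
elim: p dl dr u => [|p IH] dl dr u uH.
  (* In degree 0, freezing u at the left node of each cell makes the error vanish there, as the
     Poincare inequality demands. *)
  exists (fun k => (u k).[node R n k]%:P); split=> //.
    by split=> // k _; rewrite (leq_trans (size_polyC_leq1 _)).
  rewrite /pwdot mulr_sumr; apply: ler_sum => k _.
  have /= := @pint_poincare R (node R n k) (node R n k.+1)
    (u k - (u k).[node R n k]%:P) (ltW (node_lt R n_gt0 k)) _.
  rewrite hornerD hornerN hornerC subrr derivB derivC subr0 node_step// exprVn.
  by rewrite -!expr2; apply.
have [z [zr zP]] := pwreg_projection n_gt0 p (~~ dl) (~~ dr) (pwderiv u).
have [uc u0 u1] := uH.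
(* With Dirichlet conditions at both ends, constants are regular for the opposite conditions, so u'
   - z has mean zero and admits an antiderivative vanishing at both ends. *)
have one_reg : dl -> dr -> pwreg n p (~~ dl) (~~ dr) (fun=> 1 : {poly R}).
  move=> -> ->; split=> [k _|j k _ _|[|j] _ _ //|[|j] _ _ //].
  - by rewrite size_poly1.
  - by [].
  - by rewrite derivSn derivC raddf0 horner0.
  - by rewrite derivSn derivC raddf0 horner0.
have e_mean : dl -> dr -> dot (pwderiv u - z) (fun=> 1) = 0.
  by move=> dlT drT; exact/zP/one_reg.
have [e [e' eH e0]] := pwantideriv_ex n_gt0 e_mean.
have [psi [psi' psiH _]] := pwantideriv_ex (dl := ~~ dl) (dr := ~~ dr) n_gt0 e0.
have [w2 [w2r w2E _]] := IH _ _ _ psiH.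
have w' : pwderiv (u - e) = z by rewrite pwderivB e' opprB addrC subrK.
have [ze_le e'_le] := ortho_le (zP _ zr).
(* Writing w as u - e lets it inherit the boundary conditions of u and e. *)
exists (u - e); split.
- apply: pwreg_antideriv; last by rewrite w'.
  by rewrite addrC -scaleN1r; exact: pwH1L.
- rewrite opprB addrC subrK.
  have ee : dot e e = - dot (pwderiv e) (psi - w2).
    have [ec el er] := eH; have [pc pl pr] := psiH.
    rewrite dotBr e' (zP _ w2r) subr0 -e' -{2}psi'; apply/eqP.
    rewrite -addr_eq0 addrC pw_parts//.
    have -> : (e n.-1).[1] * (psi n.-1).[1] = 0.
      by have [d|d] := boolP dr; [rewrite er// mul0r|rewrite pr// mulr0].
    have [d|d] := boolP dl; first by rewrite el// mul0r subrr.
    by rewrite pl// mulr0 subrr.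
  have := dotCS (pwderiv e) (psi - w2); rewrite -sqrrN -ee.
  (* One factor |e|^2 is cancelled from |e|^4 <= |e'|^2 |psi - w2|^2 <= |e'|^2 (4/n^2) |e|^2. *)
  have [->|a0] := eqVneq (dot e e) 0.
    by rewrite !mulr_ge0 ?dot_ge0 ?invr_ge0 ?exprn_ge0.
  have ap : 0 < dot e e by rewrite lt_def a0 dot_ge0.
  move=> /le_trans/(_ (ler_wpM2l (dot_ge0 _) w2E)).
  rewrite psi' expr2 [in X in _ <= X]mulrA ler_pM2r// mulrC => /le_trans; apply.
  by rewrite ler_wpM2l ?divr_ge0 ?exprn_ge0// e'.
- by rewrite w'.
Qed.

(** The two estimates give |r' - w'|^2 <= 12 n^2 (4/n^2) |u'|^2 = 48 |u'|^2, and 98 = 2 (48 + 1)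
    comes from r' = (r' - w') + w'. *)
Lemma pwreg_stable p dl dr u r : pwH1 n dl dr u -> pwreg n p.+1 dl dr r ->
  (forall s, pwreg n p.+1 dl dr s -> dot (u - r) s = 0) ->
  dot (pwderiv r) (pwderiv r) <= 98 * dot (pwderiv u) (pwderiv u).
Proof.
move=> uH rr rP; have [w [wr wE wS]] := pwreg_approx p.+1 uH.
have rwr : pwreg n p.+1 dl dr (r - w).
  by rewrite addrC -scaleN1r; exact: pwregL.
have inv := pwreg_inverse rwr.
have [rw_le _] : dot (r - w) (r - w) <= dot (u - w) (u - w) /\
    dot (u - w - (r - w)) (u - w - (r - w)) <= dot (u - w) (u - w).
  by apply: ortho_le; rewrite (_ : _ - _ - _ = u - r) ?rP// opprB addrA subrK.
have key : dot (pwderiv r - pwderiv w) (pwderiv r - pwderiv w) <=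
    48 * dot (pwderiv u) (pwderiv u).
  rewrite -pwderivB (le_trans inv)//.
  have n2 : 0 < n%:R ^+ 2 :> R by rewrite exprn_gt0.
  have := le_trans rw_le wE; rewrite -(ler_pM2l n2) => h.
  have e : n%:R ^+ 2 * (4 / n%:R ^+ 2 * dot (pwderiv u) (pwderiv u)) =
     4 * dot (pwderiv u) (pwderiv u) by field; rewrite gt_eqF.
  by rewrite e in h; rewrite -mulrA; lra.
have := wS isT.
(* With a = r' - w' and b = w', |a - b|^2 >= 0 says |a + b|^2 <= 2 |a|^2 + 2 |b|^2. *)
have := dot_ge0 (pwderiv r - pwderiv w - pwderiv w).
move: key; rewrite !dotBl !dotBr (pwdotC n (pwderiv w) (pwderiv r)).
lra.
Qed.

End RegularSplines.

(** * Limits and derivatives of functions given by pieces *)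

Section Pieces.
Variables (R : realType) (n : nat).
Hypothesis n_gt0 : (0 < n)%N.
Local Notation pw := (nat -> {poly R}).
Local Notation node := (@node R n).
Implicit Types (q : pw) (v f : R -> R).

Let cell k : set R := `[node k, node k.+1].

(** This makes limits along the interval unique. Nearby points are taken to the right of x, or to
    the left if x = b. *)
Lemma punctured_itv_proper (a b x : R) : a < b -> a <= x <= b ->
  ProperFilter (within `[a, b] x^').
Proof.
move=> ab /andP[ax xb]; apply: Build_ProperFilter_ex => P /=.
rewrite /within/= => /nbhs_ballP[e /= e0 xP].
have [xb'|bx] := ltP x b.
  pose y := x + Num.min (e / 2) (b - x).
  have m0 : 0 < Num.min (e / 2) (b - x) by rewrite lt_min divr_gt0//= subr_gt0.
  have me : Num.min (e / 2) (b - x) < e by rewrite gt_min; apply/orP; left; lra.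
  have mb : Num.min (e / 2) (b - x) <= b - x by rewrite ge_min lexx orbT.
  exists y; apply: xP.
  - by rewrite /ball/= /y opprD addNKr normrN gtr0_norm.
  - by rewrite /y gt_eqF//; lra.
  - by rewrite /= in_itv/= /y; lra.
pose y := x - Num.min (e / 2) (b - a).
have m0 : 0 < Num.min (e / 2) (b - a) by rewrite lt_min divr_gt0//= subr_gt0.
have me : Num.min (e / 2) (b - a) < e by rewrite gt_min; apply/orP; left; lra.
have mb : Num.min (e / 2) (b - a) <= b - a by rewrite ge_min lexx orbT.
exists y; apply: xP.
- by rewrite /ball/= /y opprB addrC subrK gtr0_norm.
- by rewrite /y lt_eqF//; lra.
- by rewrite /= in_itv/= /y; lra.
Qed.

Lemma horner_cvg_within (A : set R) (r : {poly R}) (x : R) (G : set_system R) :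
  Filter G -> G --> x -> horner r @ within A G --> r.[x].
Proof.
move=> GF Gx; apply: cvg_trans; last exact: (@continuous_horner _ r x).
by apply: cvg_fmap2; apply: cvg_trans Gx; exact: cvg_within.
Qed.

(** By the factor theorem f - f(x) = r (X - x): off x the quotient is the polynomial r, and r(x) =
    f'(x). *)
Lemma diff_quot_poly_cvg (a b x : R) (f : {poly R}) v :
  (forall y, a <= y <= b -> v y = f.[y]) -> a <= x <= b ->
  diff_quot v x @ within `[a, b] x^' --> f^`().[x].
Proof.
move=> vf xab.
have /factor_theorem[r rE] : root (f - f.[x]%:P) x.
  by rewrite rootE !hornerE subrr.
have fE : f = r * ('X - x%:P) + f.[x]%:P by rewrite -rE subrK.
have -> : f^`().[x] = r.[x].
  rewrite [X in X^`()]fE derivD derivC addr0 derivM derivXsubC mulr1.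
  by rewrite !hornerE subrr mulr0 add0r.
apply: cvg_trans (@horner_cvg_within `[a, b] r x x^' _ (cvg_within _)).
apply: near_eq_cvg.
near=> y.
have yab : a <= y <= b.
  by rewrite -[_ <= _ <= _]/(y \in `[a, b]); near: y; exact: withinT.
have yx : y - x != 0.
  by rewrite subr_eq0; near: y; apply: cvg_within; exact: withinT.
have fy : f.[y] = r.[y] * (y - x) + f.[x] by rewrite [in LHS]fE !hornerE.
by rewrite /diff_quot !vf// fy addrK mulfK.
Unshelve. all: by end_near.
Qed.

Lemma cells_cover x : 0 <= x <= 1 -> exists2 k, (k < n)%N & cell k x.
Proof.
move=> /andP[x0]; rewrite -(node_last R n_gt0).
have := leqnn n; rewrite -{1}(prednK n_gt0).
elim: n.-1 => [n1 x1|m IH mn xm].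
  by exists 0 => //; rewrite /cell/= in_itv/= node0 x0.
have [xm'|mx] := leP x (node m.+1); first by apply: IH => //; exact: ltnW.
by exists m.+1 => //; rewrite /cell/= in_itv/= xm ltW.
Qed.

(** Finitely many cells cover [0, 1], and those missing x, being closed, miss a neighbourhood of
    x. *)
Lemma cvg_cells (G : set_system R) f (x l : R) : Filter G -> G --> x ->
  (forall k, (k < n)%N -> cell k x -> f @ within (cell k) G --> l) ->
  f @ within `[0, 1] G --> l.
Proof.
move=> GF Gx fl A lA; rewrite /fmap/= /within/=.
have : \forall y \near G, forall k : 'I_n, cell k y -> A (f y).
  apply: filter_forall => k; have [xk|xk] := pselect (cell k x).
    exact: (fl k).
  have : nbhs x (~` cell k).
    by apply: open_nbhs_nbhs; split=> //; exact/closed_openC/itv_closed.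
  by move=> /Gx; apply: filterS => y yk /yk.
apply: filterS => y yA; rewrite /= in_itv/= => /cells_cover[k kn yk].
exact: (yA (Ordinal kn)).
Qed.

Lemma node_le i j : (node i <= node j) = (i <= j)%N.
Proof. by rewrite /node ler_pM2r ?invr_gt0 ?ltr0n// ler_nat. Qed.

Lemma cell01 k x : (k < n)%N -> cell k x -> 0 <= x <= 1.
Proof.
rewrite /cell/= in_itv/= => kn /andP[kx xk].
rewrite (le_trans _ kx) -?(node0 R n) ?node_le//=.
by rewrite (le_trans xk)// -(node_last R n_gt0) node_le prednK.
Qed.

Lemma cells_consistent q x i j : pwcont n q -> (i < n)%N -> (j < n)%N ->
  cell i x -> cell j x -> (q i).[x] = (q j).[x].
Proof.
move=> qc; wlog ij : i j / (i < j)%N => [H|] iN jN; rewrite /cell/= !in_itv/=.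
  move=> xi xj; have [ij|ji|->//] := ltngtP i j; first exact: H.
  by symmetry; exact: H.
move=> /andP[_ xi] /andP[jx _].
have := le_trans jx xi; rewrite node_le => ji.
have e : j = i.+1 by apply/eqP; rewrite eqn_leq ij ji.
have -> : x = node i.+1 by apply/le_anti; rewrite xi -e.
by rewrite e qc// -e.
Qed.

Definition pieces q v := forall k x, (k < n)%N -> cell k x -> v x = (q k).[x].

Lemma pieces_diff_quot_cvg q v x l : pieces q v ->
  (forall k, (k < n)%N -> cell k x -> (q k)^`().[x] = l) ->
  diff_quot v x @ punctured01 x --> l.
Proof.
move=> qv ql; apply: cvg_cells; first exact: cvg_within.
move=> k kn xk; rewrite -(ql k kn xk); apply: diff_quot_poly_cvg.
  by move=> y yk; apply: qv => //; rewrite /cell/= in_itv.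
by move: xk; rewrite /cell/= in_itv.
Qed.

Lemma punctured_cell_proper k x :
  cell k x -> ProperFilter (within (cell k) x^').
Proof.
rewrite /cell/= in_itv => xk; apply: punctured_itv_proper => //.
exact: node_lt.
Qed.

Lemma punctured_cell_cvg k x :
  (k < n)%N -> within (cell k) x^' `=>` punctured01 x.
Proof.
move=> kn A; rewrite /punctured01 /within/=; apply: filterS => y yA yk.
by apply: yA; rewrite in_itv/=; exact: cell01 yk.
Qed.

Lemma deriv01_cvg f x l : 0 <= x <= 1 -> diff_quot f x @ punctured01 x --> l ->
  deriv01 f x = l.
Proof.
move=> x01 fl; have xP := punctured_itv_proper (@ltr01 R) x01.
exact: (@cvg_lim _ _ _ (punctured01 x)).
Qed.

(** Once the limit is known to exist, it may be computed inside a single cell. *)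
Lemma pieces_deriv01 q v k x : pieces q v -> (k < n)%N -> cell k x ->
  derivable01 v x -> deriv01 v x = (q k)^`().[x].
Proof.
move=> qv kn xk dv; have kP := punctured_cell_proper xk.
apply: (@cvg_unique _ _ (diff_quot v x @ within (cell k) x^')) => //.
  by apply: cvg_trans dv; apply: cvg_fmap2; exact: punctured_cell_cvg.
apply: diff_quot_poly_cvg.
  by move=> y yk; apply: qv => //; rewrite /cell/= in_itv.
by move: xk; rewrite /cell/= in_itv.
Qed.

End Pieces.

(** * Correspondence between splines and their pieces *)

Section SplineBridge.
Variables (R : realType) (n : nat).
Hypothesis n_gt0 : (0 < n)%N.
Local Notation pw := (nat -> {poly R}).
Local Notation node := (@node R n).
Local Notation cell k := (`[node k, node k.+1]%classic : set R).
Local Notation pieces := (@pieces R n).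
Implicit Types (q : pw) (v f : R -> R) (D : set R).

Definition pwderivn j q : pw := iter j (@pwderiv R) q.

Lemma pwderivnE j q k : pwderivn j q k = (q k)^`(j).
Proof. by elim: j => [//|j IH]; rewrite derivnS -IH. Qed.

Lemma C01_pieces p q v : C01 p v -> pieces q v ->
  forall j, (j <= p)%N -> pieces (pwderivn j q) (deriv01n j v).
Proof.
move=> [dv _] qv; elim=> [//|j IH] jp k x kn xk.
rewrite [pwderivn _ _]iterS; apply: (pieces_deriv01 n_gt0 (IH (ltnW jp))) => //.
by apply: dv => //; rewrite in_itv/=; exact: cell01 xk.
Qed.

Lemma cell_left k : cell k (node k).
Proof. by rewrite /= in_itv/= lexx ltW ?node_lt. Qed.

Lemma cell_right k : cell k (node k.+1).
Proof. by rewrite /= in_itv/= lexx ltW ?node_lt. Qed.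

Lemma pieces_cont q v : pieces q v -> pwcont n q.
Proof.
move=> qv k kn; rewrite -(qv k)//; [|exact: ltnW|exact: cell_right].
by rewrite -(qv k.+1)//; exact: cell_left.
Qed.

Lemma pieces0 q v : pieces q v -> v 0 = (q 0).[0].
Proof. by move=> qv; apply: qv => //; have := cell_left 0; rewrite node0. Qed.

Lemma pieces1 q v : pieces q v -> v 1 = (q n.-1).[1].
Proof.
move=> qv; apply: qv; first by rewrite ltn_predL.
by have := cell_right n.-1; rewrite node_last.
Qed.

Lemma spline_pieces p v : spline p n v -> exists q,
  [/\ pieces q v, forall k, (k < n)%N -> (size (q k) <= p.+1)%N &
      forall j, (j <= p.-1)%N -> pieces (pwderivn j q) (deriv01n j v)].
Proof.
move=> [vC vp].
have : forall k, exists q : {poly R}, (k < n)%N -> (size q <= p.+1)%N /\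
    forall x, cell k x -> v x = q.[x].
  move=> k; have [kn|_] := ltnP k n; last by exists 0.
  by have [q [qs qv]] := vp k kn; exists q => _; split=> // x xk; exact: qv.
move=> /choice[q qP]; exists q.
have qv : pieces q v by move=> k x kn; case: (qP k kn) => _; exact.
split=> //; first by move=> k /qP[].
exact: C01_pieces.
Qed.

Lemma splineD_pieces p D v : splineD p n D v ->
  exists q, pieces q v /\ pwH1 n `[< D 0 >] `[< D 1 >] q.
Proof.
move=> [/spline_pieces[q [qv _ _]] vD]; exists q; split=> //.
split; [exact: pieces_cont qv|..] => /asboolP /vD.
- by rewrite (pieces0 qv).
- by rewrite (pieces1 qv).
Qed.

Lemma splineD_reg_vanish p D v x j : [set 0; 1] x -> splineD_reg p.+1 n D v ->
  (j < p.+1)%N -> odd j (+) `[< D x >] -> deriv01n j v x = 0.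
Proof.
move=> x01 [[_ vD] v_even v_odd] jp.
have [oj|oj] /= := boolP (odd j); have [Dx|nDx] := pselect (D x);
  rewrite ?(asboolT Dx) ?(asboolF nDx)// => _.
- have -> : j = (j./2).*2.+1 by have := odd_double_half j; rewrite oj.
  by apply: v_odd => //; lia.
- case: j jp oj => [_ _|j jp oj]; first exact: vD.
  have -> : j.+1 = (j.+1./2).*2.
    by have := odd_double_half j.+1; rewrite (negbTE oj) add0n.
  by apply: v_even => //; lia.
Qed.

Lemma splineD_reg_pieces p D v : splineD_reg p.+1 n D v ->
  exists q, pieces q v /\ pwreg n p.+1 `[< D 0 >] `[< D 1 >] q.
Proof.
move=> vr; have [[vs _] _ _] := vr.
have [q [qv qs qd]] := spline_pieces vs; exists q; split=> //.
split=> // [j k jp kn|j jp jD|j jp jD]; rewrite -!pwderivnE.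
- exact: (pieces_cont (qd j jp)).
- by rewrite -(pieces0 (qd j jp)); apply: (splineD_reg_vanish _ vr) => //; left.
- by rewrite -(pieces1 (qd j jp)); apply: (splineD_reg_vanish _ vr) => //; right.
Qed.

Lemma pieces_ex q : pwcont n q -> exists v, pieces q v.
Proof.
move=> qc.
have : forall x, exists y, forall k, (k < n)%N -> cell k x -> y = (q k).[x].
  move=> x; have [[k kn xk]|xN] := pselect (exists2 k, (k < n)%N & cell k x).
    by exists (q k).[x] => j jn xj; exact: (cells_consistent n_gt0 qc).
  (* An arbitrary value for the points outside all cells. *)
  by exists 0 => k kn xk; exfalso; apply: xN; exists k.
by move=> /choice[v vP]; exists v => k x kn xk; exact: vP.
Qed.

(** The pieces agree at the nodes up to order p. Hence, order by order, the difference quotients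
    converge across the nodes too, and each derivative of v is again given by pieces. *)
Lemma pwreg_C01 p dl dr q v : pwreg n p.+1 dl dr q -> pieces q v -> C01 p v.
Proof.
move=> [_ qc _ _] qv.
have dc j : (j <= p)%N -> pwcont n (pwderivn j q).
  by move=> jp k kn; rewrite !pwderivnE; exact: qc.
have dq j x : (j < p)%N -> 0 <= x <= 1 -> pieces (pwderivn j q) (deriv01n j v) ->
    exists2 k, (k < n)%N /\ cell k x &
    diff_quot (deriv01n j v) x @ punctured01 x --> (pwderivn j.+1 q k).[x].
  move=> jp x01 jv; have [k kn xk] := cells_cover n_gt0 x01; exists k => //.
  apply: (pieces_diff_quot_cvg n_gt0 jv) => i iN xi.
  exact: (cells_consistent n_gt0 (dc j.+1 jp)).
have jv j : (j <= p)%N -> pieces (pwderivn j q) (deriv01n j v).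
  elim: j => [//|j IH] jp k x kn xk.
  have x01 := cell01 n_gt0 kn xk.
  have [i [iN xi] /(deriv01_cvg x01) e] := dq _ _ jp x01 (IH (ltnW jp)).
  rewrite [LHS]e; exact: (cells_consistent n_gt0 (dc j.+1 jp)).
split=> [j x jp|].
  rewrite in_itv/= => x01; have [k _ kc] := dq _ _ jp x01 (jv _ (ltnW jp)).
  by apply/cvg_ex; eexists; exact: kc.
apply/subspace_continuousP => x /= x01.
apply: (@cvg_cells R n n_gt0 (nbhs x) _ x) => [//|k kn xk].
rewrite /from_subspace (jv p (leqnn p) k x kn xk).
apply: (cvg_trans _ (@horner_cvg_within R (cell k) (pwderivn p q k) x (nbhs x)
  _ (fun _ => id))).
apply: near_eq_cvg.
near=> y; symmetry; apply: (jv p (leqnn p)) => //.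
by near: y; exact: withinT.
Unshelve. all: by end_near.
Qed.

Lemma pwreg_splineD_reg p D q v : D `<=` [set 0; 1] ->
  pwreg n p.+1 `[< D 0 >] `[< D 1 >] q -> pieces q v -> splineD_reg p.+1 n D v.
Proof.
move=> D01 qr qv; have vC := pwreg_C01 qr qv.
have [qs qc q0 q1] := qr.
have jv := C01_pieces vC qv.
have van x j : [set 0; 1] x -> (j < p.+1)%N -> odd j (+) `[< D x >] ->
    deriv01n j v x = 0.
  move=> [] -> jp jD.
  - by rewrite (pieces0 (jv j jp)) pwderivnE q0.
  - by rewrite (pieces1 (jv j jp)) pwderivnE q1.
split.
- split; last by move=> x Dx; apply: (van x 0) => //; [exact: D01|rewrite asboolT].
  split=> // k kn; exists (q k); split; first exact: qs.
  by move=> x; exact: qv.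
- move=> k x kp Dx; apply: van; [exact: D01| |by rewrite odd_double asboolT].
  by lia.
- move=> k x kp [x01 nDx]; apply: van => //; last by rewrite /= odd_double asboolF.
  by lia.
Qed.

End SplineBridge.

(** * Lebesgue integrals and H^1 seminorms from pieces *)

Section NormBridge.
Variables (R : realType) (n : nat).
Hypothesis n_gt0 : (0 < n)%N.
Local Notation pw := (nat -> {poly R}).
Local Notation node := (@node R n).
Implicit Types (q r : pw) (v f g : R -> R).

(** Nodes are left out because [deriv01 v] is not meaningful at a kink; they do not affect
    integrals. *)
Definition open_pieces q f := forall k x, (k < n)%N ->
  node k < x < node k.+1 -> f x = (q k).[x].

(** Cells are added one at a time; measurability is carried along because splitting the integral
    needs it. *)
Lemma L2dot_open_pieces q r f g : open_pieces q f -> open_pieces r g ->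
  L2dot f g = pwdot n q r.
Proof.
move=> qf rg.
suff H m : (m <= n)%N -> measurable_fun `[0, node m] (fun x => f x * g x) /\
    (\int[@lebesgue_measure R]_(x in `[0%R, node m]) (f x * g x)%:E =
     (\sum_(k < m) pint (node k) (node k.+1) (q k * r k))%:E)%E.
  have [_] := H n (leqnn n).
  rewrite (_ : node n = 1); last by rewrite -(node_last R n_gt0) prednK.
  by rewrite /L2dot /Rintegral => ->.
elim: m => [_|m IH mn].
  rewrite node0 set_itv1; split; first exact: measurable_fun_set1.
  by rewrite integral_set1 big_ord0.
have [mI IE] := IH (ltnW mn).
have fgE (x : R) : node m < x < node m.+1 -> f x * g x = (q m * r m).[x].
  by move=> xm; rewrite hornerM (qf m)// (rg m).
have moo : measurable_fun `]node m, node m.+1[ (fun x => f x * g x).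
  apply: (eq_measurable_fun (horner (q m * r m))).
    by move=> x; rewrite inE/= in_itv/= => /fgE.
  apply: (measurable_funS measurableT) => //.
  by apply: continuous_measurable_fun; exact: continuous_horner.
have moc : measurable_fun `]node m, node m.+1] (fun x => f x * g x).
  exact/measurable_fun_itv_bndo_bndcP.
have Ioc : (\int[@lebesgue_measure R]_(x in `]node m, node m.+1]) (f x * g x)%:E =
    (pint (node m) (node m.+1) (q m * r m))%:E)%E.
  rewrite integral_itv_bndoo; last exact/measurable_EFinP.
  rewrite -integral_horner ?node_lt//.
  rewrite [RHS]integral_itv_bndoo; last first.
    apply/measurable_EFinP/(measurable_funS measurableT) => //.
    by apply: continuous_measurable_fun; exact: continuous_horner.
  by apply: eq_integral => x; rewrite inE/= in_itv/= => /fgE ->.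
have -> : `[0, node m.+1]%classic = `[0, node m] `|` `]node m, node m.+1] :> set R.
  apply: itv_bndbnd_setU; rewrite bnd_simp; first by rewrite -(node0 R n) node_le.
  exact/ltW/node_lt.
split; first exact/measurable_funU.
rewrite integral_setU//.
- by rewrite IE Ioc big_ord_recr/= EFinD.
- exact/measurable_EFinP/measurable_funU.
- apply/disj_setPS => x [] /=; rewrite !in_itv/= => /andP[_ xm] /andP[mx _].
  by move: (lt_le_trans mx xm); rewrite ltxx.
Qed.

Lemma pieces_open q v : pieces n q v -> open_pieces q v.
Proof.
move=> qv k x kn /andP[kx xk]; apply: qv => //.
by rewrite /= in_itv/= !ltW.
Qed.

Lemma pieces_open_deriv q v : pieces n q v -> open_pieces (pwderiv q) (deriv01 v).
Proof.
move=> qv k x kn /andP[kx xk].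
have kc : `[node k, node k.+1]%classic x by rewrite /= in_itv/= !ltW.
apply: deriv01_cvg; first exact: (cell01 n_gt0 kn).
apply: (pieces_diff_quot_cvg n_gt0 qv) => i iN; rewrite /= in_itv/= => /andP[ix xi].
suff -> : i = k by [].
have := le_lt_trans ix xk; have := lt_le_trans kx xi.
rewrite !ltNge !(node_le R n_gt0) -!ltnNge !ltnS => ki ik.
by apply/eqP; rewrite eqn_leq ik.
Qed.

Lemma H1semi_pieces q v : pieces n q v ->
  H1semi v ^+ 2 = pwdot n (pwderiv q) (pwderiv q).
Proof.
move=> /pieces_open_deriv qv; rewrite /H1semi /L2norm (L2dot_open_pieces qv qv).
by rewrite sqr_sqrtr// pwdot_ge0.
Qed.

End NormBridge.

(** * Equivalence of the seminorms, from the stability of the projection *)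

Theorem theorem1 (R : realType) :
  exists c C : R, [/\ 0 < c, 0 < C &
    forall (p n : nat) (D : set R) (v v_reg v_out : R -> R),
      (1 <= p)%N -> (1 <= n)%N -> D `<=` [set 0; 1] ->
      splineD p n D v -> splineD_reg p n D v_reg -> splineD_out p n D v_out ->
      {in `[0, 1], forall x, v x = v_reg x + v_out x} ->
      c * (H1semi v_reg ^+ 2 + H1semi v_out ^+ 2) <= H1semi v ^+ 2 /\
      H1semi v ^+ 2 <= C * (H1semi v_reg ^+ 2 + H1semi v_out ^+ 2)].
Proof.
(* Stability gives |v_reg|_1^2 <= 98 |v|_1^2, so |v_out|_1^2 <= 2 (1 + 98) |v|_1^2, and 98 + 198 =
   296. *)
exists 296^-1, 2; split=> // [[//|p] n D v v_reg v_out _ n_gt0 D01 vS rS oS vE].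
have [u [uv uH]] := splineD_pieces n_gt0 vS.
have [r [rv rr]] := splineD_reg_pieces n_gt0 rS.
have ov : pieces n (u - r) v_out.
  move=> k x kn xk; rewrite hornerD hornerN -(uv k x)// -(rv k x)// vE.
    by rewrite addrC addKr.
  by rewrite in_itv/=; exact: (cell01 n_gt0 kn).
(* Orthogonality is assumed for functions, so the pieces [s] are first glued into a regular
   spline. *)
have orth s : pwreg n p.+1 `[< D 0 >] `[< D 1 >] s -> pwdot n (u - r) s = 0.
  move=> sr; have [_ sc _ _] := sr.
  have [w sw] := pieces_ex n_gt0 (fun k => sc 0 k isT).
  rewrite -(L2dot_open_pieces n_gt0 (pieces_open ov) (pieces_open sw)).
  exact/oS.2/(pwreg_splineD_reg n_gt0 D01 sr).
have stab := pwreg_stable n_gt0 uH rr orth.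
rewrite !(H1semi_pieces n_gt0 uv, H1semi_pieces n_gt0 rv, H1semi_pieces n_gt0 ov).
rewrite pwderivB; move: (pwderiv u) (pwderiv r) stab => u' r' stab.
have dot_ge0 := @pwdot_ge0 R n n_gt0.
have dotBl := form_subl (@pwdotL R n).
have dotBr := form_subr (@pwdotC R n) (@pwdotL R n).
(* These squares bound |u' - r'|^2 by 2 |u'|^2 + 2 |r'|^2 and |u'|^2 by 2 |u' - r'|^2 + 2 |r'|^2. *)
have := dot_ge0 (1 *: u' + r'); have := dot_ge0 (u' - r' - r').
rewrite pwdotL !(pwdotC _ _ (1 *: u' + r')) !pwdotL !dotBl !dotBr.
rewrite (pwdotC n r' u') => h1 h2; have := dot_ge0 u'; have := dot_ge0 r'.
by split; lra.
Qed.
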